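(* Let $t=[0,a_1,a_2,\dots]$ be the irrational number in $(0,1)$ whose regular continued fraction has partial quotients $a_i$, where $a_i$ is the integer consisting of a tower of $i$ twos with an $i$ on top; that is, $a_1=2^1=2$, $a_2=2^{2^2}$, $a_3=2^{2^{2^3}}$, and so on. If $y=\exp(2\pi i t)$, then the continued fraction $K(y)$ diverges.
   Context: The tower can be described as $a_i=T_i(i)$, where $T_0(z)=z$ and $T_{j+1}(z)=2^{T_j(z)}$. For $x\in\mathbb{C}$, $K(x)$ is the continued fraction $$K(x)=1+\cfrac{x}{1+\cfrac{x^2}{1+\cfrac{x^3}{1+\ddots}}}.$$ Its $n$-th convergent is $K_n(x)=P_n(x)/Q_n(x)$, where $P_0=1$, $P_1=1+x$, $Q_0=Q_1=1$, and $P_{n+1}(x)=P_n(x)+x^{n+1}P_{n-1}(x)$, $Q_{n+1}(x)=Q_n(x)+x^{n+1}Q_{n-1}(x)$ for $n\ge1$. The continued fraction $K(x)$ converges if the sequence $P_n(x)/Q_n(x)$ has a limit in $\hat{\mathbb{C}}=\mathbb{C}\cup\{\infty\}$, and diverges otherwise. *)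

(* Defs.v *)
From HB Require Import structures.
From mathcomp Require Import all_boot all_order all_algebra.
From mathcomp Require Import all_classical all_reals all_analysis.
From mathcomp Require Import complex.

Set Implicit Arguments.
Unset Strict Implicit.
Unset Printing Implicit Defensive.

Import Order.TTheory GRing.Theory Num.Theory.
Import numFieldNormedType.Exports.

Local Open Scope classical_set_scope.
Local Open Scope ring_scope.
Local Open Scope complex_scope.

Fixpoint tower (j z : nat) : nat :=
  if j is j'.+1 then (2 ^ tower j' z)%N else z.

(* [0, b_1, ..., b_n] = 1 / (b_1 + 1 / (b_2 + ... + 1 / b_n)) for
   s = [:: b_1; ...; b_n] *)
Fixpoint cfrac (R : realType) (s : seq nat) : R :=
  if s is b :: s' then (b%:R + cfrac R s')^-1 else 0.

(* t = [0, a_1, a_2, ...] as a regular continued fraction; the value a 0 is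
   not used. *)
Definition regular_cfrac (R : realType) (a : nat -> nat) (t : R) : Prop :=
  (forall i, (0 < i)%N -> (0 < a i)%N) /\
  (fun n : nat => cfrac R [seq a i | i <- iota 1 n]) @ \oo --> t.

Definition cexp (R : realType) (z : R[i]) : R[i] :=
  (expR (complex.Re z))%:C * (cos (complex.Im z) +i* sin (complex.Im z)).

Fixpoint KP (R : realType) (x : R[i]) (n : nat) : R[i] :=
  match n with
  | 0 => 1
  | 1 => 1 + x
  | (m.+1 as n').+1 => KP x n' + x ^+ n'.+1 * KP x m
  end.

Fixpoint KQ (R : realType) (x : R[i]) (n : nat) : R[i] :=
  match n with
  | 0 => 1
  | 1 => 1
  | (m.+1 as n').+1 => KQ x n' + x ^+ n'.+1 * KQ x m
  end.

(* The complex plane with its norm topology (that of R[i]^o), together with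
   the point at infinity None *)
Definition Chat (R : realType) : topologicalType :=
  one_point_compactification (R[i]^o).

(* P_n(x) / Q_n(x) in the extended plane. There is no 0/0 case: P_n(x) and
   Q_n(x) do not vanish together, since P_n Q_(n-1) - P_(n-1) Q_n is, up to
   sign, a power of x, and P_n(0) = Q_n(0) = 1. *)
Definition Kconvergent (R : realType) (x : R[i]) (n : nat) : Chat R :=
  if KQ x n == 0 then None else Some (KP x n / KQ x n).

Definition K_converges (R : realType) (x : R[i]) : Prop :=
  exists l : Chat R, Kconvergent x @ \oo --> l.

(* Main.v *)
Require Import Defs.
From HB Require Import structures.
From mathcomp Require Import all_boot all_order all_algebra.
From mathcomp Require Import all_classical all_reals all_analysis.
From mathcomp Require Import complex.
From mathcomp Require Import zify ring lra.
Import Order.TTheory GRing.Theory Num.Theory.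
Import numFieldNormedType.Exports.
Local Open Scope ring_scope.
Local Open Scope complex_scope.
Set Implicit Arguments.
Unset Strict Implicit.

(** The proof compares [y] with a very close root of unity at which
    neighbouring convergents are [oo] and [0].

    Let [x] be a primitive [m]-th root of unity with [5 %| m]. Schur's finite
    form of the Rogers-Ramanujan identities writes the denominator [Q_(m-1)]
    as an alternating sum of Gaussian binomials [[m; k]], where [k] is never
    divisible by 5; at [x] all of these vanish ([qbin_unity]), hence
    [Q_(m-1)(x) = 0] ([KQ_unity]). Reading the sequence of coefficients
    backwards exchanges numerators and denominators and replaces [x] by
    [1/x], so that [P_(m-2)(x) = Q_(m-1)(1/x) = 0] as well ([KP_reverse]).
    The determinant identity ([KPQ_det]) then gives
    [|P_(m-1)(x)| |Q_(m-2)(x)| = 1], and as [|P_n|] and [|Q_n|] are at most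
    [2^n] on the unit circle, neither factor is smaller than [2^-m].

    On the unit circle [P_n] and [Q_n] are Lipschitz with constant [4^n]
    ([q_recurrent_lipschitz]). Therefore, if [|y| = 1] and
    [|y - x| <= 16^-m], the convergent of index [m-1] of [K(y)] is infinite
    or of modulus at least [2^m - 1], while the one of index [m-2] has modulus
    at most [1 / (2^m - 1)] ([convergents_near_unity]). If such [x] exist for
    arbitrarily large [m], the sequence of convergents has no limit in the
    extended plane ([Chat_cvg_dichotomy]).

    It remains to find such roots of unity near [y = exp(2 pi i t)]. They
    come from the convergents [c/d] of the regular continued fraction of [t]:
    [|t - c/d|] is at most the inverse of the next partial quotient, a tower
    that is at least [16^(d+1)] from the third convergent on. As [a_1 = 2] and
    [a_i = 1] modulo 5 for [i >= 2], the denominators [d] run modulo 5 through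
    a Fibonacci sequence, and every fifth one is divisible by 5
    ([tower_cfrac_approx]). *)

(** * Gaussian binomials with an integer lower index *)

(** The lower index ranges over all of [int], so that the sums below run over
    an interval of [int] chosen once and for all, without boundary cases. *)
Fixpoint qbin (F : fieldType) (q : F) (n : nat) (k : int) : F :=
  if n is m.+1 then qbin q m k + q ^ (n%:Z - k) * qbin q m (k - 1)
  else (k == 0)%:R.

Lemma qbin_lt0 (F : fieldType) (q : F) (n : nat) (k : int) :
  k < 0 -> qbin q n k = 0.
Proof.
elim: n k => [|n IH] k k0 /=; first by rewrite lt_eqF.
by rewrite !IH ?mulr0 ?addr0 //; lia.
Qed.

Lemma qbin_gt (F : fieldType) (q : F) (n : nat) (k : int) :
  n%:Z < k -> qbin q n k = 0.
Proof.
elim: n k => [|n IH] k k0 /=; first by rewrite gt_eqF.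
by rewrite !IH ?mulr0 ?addr0 //; lia.
Qed.

(** The second Pascal rule, the first one being the definition; the
    recurrence of Schur's sums combines both. *)
Lemma qbin_pascal (F : fieldType) (q : F) (q0 : q != 0) (n : nat) (k : int) :
  qbin q n.+1 k = qbin q n (k - 1) + q ^ k * qbin q n k.
Proof.
elim: n k => [|n IH] k.
  rewrite /=; have [->|k1] := eqVneq k 1; first by rewrite subrr /= expr0z; ring.
  have [->|k0] := eqVneq k 0; first by rewrite sub0r expr0z oppr_eq0 /=; ring.
  have -> : (k - 1 == 0) = false by lia.
  by rewrite ?(negPf k0) /=; ring.
have unfold m i : qbin q m.+1 i =
  qbin q m i + q ^ (m.+1%:Z - i) * qbin q m (i - 1) by [].
rewrite [LHS]unfold [in LHS]IH [in LHS]IH !unfold.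
have -> : n.+2%:Z - k = (n.+1%:Z - (k - 1)) by lia.
rewrite !mulrDr !mulrA -!expfzDr //.
have -> : n.+1%:Z - (k - 1) + (k - 1) = k + (n.+1%:Z - k) by lia.
by ring.
Qed.

Lemma qbin_absorb (F : fieldType) (q : F) (q0 : q != 0) (n : nat) (k : int) :
  (1 - q ^ k) * qbin q n.+1 k = (1 - q ^ n.+1) * qbin q n (k - 1).
Proof.
rewrite mulrBl mul1r {1}qbin_pascal //= mulrDr mulrA -expfzDr //.
have -> : k + (n.+1%:Z - k) = n.+1%:Z by lia.
by ring.
Qed.

(** By absorption [(1 - q^k) [m; k]] has the factor [1 - q^m = 0], and
    [1 - q^k] is nonzero. *)
Lemma qbin_unity (F : fieldType) (q : F) (m : nat) (k : int) :
  m.-primitive_root q -> ~~ (m%:Z %| k)%Z -> qbin q m k = 0.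
Proof.
move=> qm; have m0 := prim_order_gt0 qm.
have q0 : q != 0 by rewrite (prim_root_eq0 qm) -lt0n.
case: k => k; last by move=> _; apply: qbin_lt0; lia.
rewrite dvdzE /= => mk; case: m m0 mk qm => // m _ mk qm.
apply: (mulfI (x := 1 - q ^ k)).
  by rewrite subr_eq0 eq_sym -exprnP -(prim_order_dvd qm).
by rewrite qbin_absorb // -exprnP (prim_expr_order qm) subrr mul0r mulr0.
Qed.

(** * Schur's alternating sums *)

(** [j (5 j - 3)] is even: these are the exponents of the theta series in the
    numerator of the second Rogers-Ramanujan identity. *)
Definition schur_exp (j : int) : int := ((j * (5 * j - 3)) %/ 2)%Z.

Lemma schur_expS j : schur_exp (j + 1) = schur_exp j + 5 * j + 1.
Proof.
rewrite /schur_exp.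
have -> : (j + 1) * (5 * (j + 1) - 3) = (5 * j + 1) * 2 + j * (5 * j - 3).
  by ring.
by rewrite divzMDl //; ring.
Qed.

Definition schur_term (F : fieldType) (q : F) (n : nat) (j : int) : F :=
  (-1) ^ j * q ^ schur_exp j * qbin q n (((n%:Z - 5 * j) %/ 2)%Z + 1).

(** Both Pascal rules applied, the defect of the term of index [j] in the
    recurrence of Schur's sums is a single binomial, whose shape depends on the
    parity of [n + 1 - 5 j]. The defects of [j] (even case) and [j + 1] (odd
    case) are opposite; [schur_telescope j] is the one attached to this pair,
    and is set to 0 when [j] is in the odd case, which turns the pairwise
    cancellation into a telescoping sum. *)
Definition schur_telescope (F : fieldType) (q : F) (n : nat) (j : int) : F :=
  let r := ((n.+1%:Z - 5 * j) %/ 2)%Z in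
  if (n.+1%:Z - 5 * j == 2 * r) then
    (-1) ^ j * q ^ (schur_exp j + n.+1%:Z - r) * qbin q n (r - 1)
  else 0.

Lemma schur_term_rec (F : fieldType) (q : F) (q0 : q != 0) (n : nat) (j : int) :
  schur_term q n.+2 j - schur_term q n.+1 j - q ^+ n.+1 * schur_term q n j
  = schur_telescope q n j - schur_telescope q n (j - 1).
Proof.
have N10 : (-1 : F) != 0 by rewrite oppr_eq0 oner_eq0.
rewrite /schur_telescope /schur_term exprnP.
set r := ((n.+1%:Z - 5 * j) %/ 2)%Z.
have unfold m i : qbin q m.+1 i =
  qbin q m i + q ^ (m.+1%:Z - i) * qbin q m (i - 1) by [].
case: ifPn => hr.
  have -> : ((n.+2%:Z - 5 * j) %/ 2)%Z = r by lia.
  have -> : ((n%:Z - 5 * j) %/ 2)%Z = r - 1 by lia.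
  rewrite ifN; last by lia.
  rewrite subrK subr0 [qbin q n.+2 _]unfold addrK.
  rewrite [qbin q n.+1 r]qbin_pascal //.
  have -> : n.+2%:Z - (r + 1) = n.+1%:Z - r by lia.
  have -> : schur_exp j + n.+1%:Z - r = schur_exp j + (n.+1%:Z - r) by ring.
  rewrite [q ^ (schur_exp j + _)]expfzDr //.
  rewrite [q ^ (n.+1%:Z - r) * (_ + _)]mulrDr [q ^ (n.+1%:Z - r) * (_ * _)]mulrA.
  rewrite -[q ^ (n.+1%:Z - r) * q ^ r]expfzDr // subrK.
  by ring.
have -> : ((n.+2%:Z - 5 * j) %/ 2)%Z = r + 1 by lia.
have -> : ((n%:Z - 5 * j) %/ 2)%Z = r by lia.
have -> : ((n.+1%:Z - 5 * (j - 1)) %/ 2)%Z = r + 3 by lia.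
rewrite ifT; last by lia.
have -> : schur_exp (j - 1) + n.+1%:Z - (r + 3) = schur_exp j + (r + 2).
  by have := schur_expS (j - 1); rewrite subrK => ->; lia.
have -> : r + 1 + 1 = r + 2 by ring.
have -> : r + 3 - 1 = r + 2 by ring.
rewrite [qbin q n.+2 _]qbin_pascal // [qbin q n.+1 (r + 2)]unfold.
have -> : r + 2 - 1 = r + 1 by ring.
have -> : (-1 : F) ^ (j - 1) = - (-1) ^ j.
  by rewrite expfzDr // exprN1 invrN1 mulrN1.
rewrite [q ^ (schur_exp j + _)]expfzDr //.
rewrite [q ^ (r + 2) * (_ + _)]mulrDr [q ^ (r + 2) * (_ * _)]mulrA.
rewrite -[q ^ (r + 2) * q ^ _]expfzDr //.
have -> : r + 2 + (n.+1%:Z - (r + 2)) = n.+1%:Z by ring.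
by ring.
Qed.

(** The bound [N] only has to be large: the terms with [|j| > N] vanish once
    [n <= N]. *)
Definition schur_sum (F : fieldType) (q : F) (N n : nat) : F :=
  \sum_(0 <= i < N.*2.+1) schur_term q n (i%:Z - N%:Z).

(** The sum telescopes to two boundary values, at [j = N] and [j = - N - 1],
    whose binomials have a lower index outside [0 .. n]. *)
Lemma schur_sum_rec (F : fieldType) (q : F) (q0 : q != 0) (N n : nat) :
  (n.+1 < N)%N ->
  schur_sum q N n.+2 = schur_sum q N n.+1 + q ^+ n.+1 * schur_sum q N n.
Proof.
move=> nN; apply/eqP; rewrite -subr_eq0 opprD addrA /schur_sum mulr_sumr -!sumrB.
pose h i := schur_telescope q n (i%:Z - N%:Z - 1).
rewrite (eq_bigr (fun i => h i.+1 - h i)); last first.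
  move=> i _; rewrite schur_term_rec // /h.
  by congr (schur_telescope _ _ _ - _); lia.
rewrite telescope_sumr // /h /schur_telescope.
rewrite qbin_lt0; last by lia.
by rewrite qbin_gt ?mulr0 ?if_same ?subrr //; lia.
Qed.

Lemma schur_sum0 (F : fieldType) (q : F) (N : nat) : schur_sum q N 0 = 0.
Proof.
rewrite /schur_sum big1_seq // => i _; rewrite /schur_term /=.
have -> : (((0%:Z - 5 * (i%:Z - N%:Z)) %/ 2)%Z + 1 == 0) = false by lia.
by rewrite mulr0.
Qed.

Lemma schur_sum1 (F : fieldType) (q : F) (N : nat) : schur_sum q N 1 = 1.
Proof.
have memN : N \in index_iota 0 N.*2.+1 by rewrite mem_index_iota; lia.
rewrite /schur_sum (bigD1_seq N memN (iota_uniq _ _)) /=.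
rewrite big1_seq ?addr0 => [|i /andP[iN _]]; rewrite /schur_term.
  by rewrite subrr mulr0 subr0 /= !expr0z /=; ring.
case: (ltnP i N) => h.
  by rewrite qbin_gt ?mulr0 //; lia.
by rewrite qbin_lt0 ?mulr0 //; lia.
Qed.

(** The lower indices are [(5 (s - j)) %/ 2 + 1] for [m = 5 s], hence 1 or 3
    modulo 5: none of them is divisible by [m]. *)
Lemma schur_sum_unity (F : fieldType) (q : F) (N m : nat) :
  (5 %| m)%N -> m.-primitive_root q -> schur_sum q N m = 0.
Proof.
move=> m5 qm; rewrite /schur_sum big1_seq // => i _.
rewrite /schur_term (qbin_unity qm) ?mulr0 //.
apply/negP => /dvdzP[c]; case/dvdnP: m5 => s ->; lia.
Qed.

(** * Numerators and denominators at roots of unity *)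

Definition q_recurrent (C : pzRingType) (x : C) (u : nat -> C) : Prop :=
  forall n, u n.+2 = u n.+1 + x ^+ n.+2 * u n.

Lemma KP_rec (R : realType) (x : R[i]) : q_recurrent x (KP x).
Proof. by []. Qed.

Lemma KQ_rec (R : realType) (x : R[i]) : q_recurrent x (KQ x).
Proof. by []. Qed.

(** The index is shifted by one: [schur_sum x N 0 = 0] stands for [Q_(-1)]. *)
Lemma KQ_schur (R : realType) (x : R[i]) (N n : nat) :
  x != 0 -> (n < N)%N -> KQ x n = schur_sum x N n.+1.
Proof.
move=> x0; have [k] := ubnP n; elim: k n => // k IH [|[|n]] nk nN.
- by rewrite schur_sum1.
- by rewrite schur_sum_rec // schur_sum1 schur_sum0 mulr0 addr0.
- by rewrite schur_sum_rec // KQ_rec !IH //; lia.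
Qed.

Lemma KQ_unity (R : realType) (x : R[i]) (m : nat) :
  (5 %| m)%N -> m.-primitive_root x -> KQ x m.-1 = 0.
Proof.
move=> m5 xm; have m0 := prim_order_gt0 xm.
have x0 : x != 0 by rewrite (prim_root_eq0 xm) -lt0n.
by rewrite (@KQ_schur _ x m) ?prednK // schur_sum_unity.
Qed.

(** The pairing [P_(a+1) q_(b+1) + x^(a+2) P_a q_b], with [q_k = Q_k(1/x)] and
    [a + b] fixed, does not change when [a] grows by one, since the recurrence
    for [q] is adjoint to the one for [P] when [x^(n+4) = 1]. Its two extreme
    values are the two sides. *)
Lemma KP_reverse (R : realType) (x : R[i]) (n : nat) :
  x ^+ n.+4 = 1 -> KP x n.+2 = KQ x^-1 n.+3.
Proof.
move=> xm; have x0 : x != 0.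
  by apply: contra_eq_neq xm => ->; rewrite expr0n /= eq_sym oner_eq0.
have xV k l : (k + l = n.+4)%N -> x^-1 ^+ k = x ^+ l.
  move=> kl; apply: (mulfI (expf_neq0 k x0)).
  by rewrite -exprD kl xm exprVn mulfV // expf_neq0.
suff inv a b : (a + b = n)%N -> KQ x^-1 n.+3 =
    KP x a.+1 * KQ x^-1 b.+1 + x ^+ a.+2 * KP x a * KQ x^-1 b.
  by rewrite (inv n 0%N) ?addn0 // KP_rec /=; ring.
(* Moving one step from [b] to [a] uses [x^-(b+2) = x^(a+3)]. *)
elim: a b => [|a IH] b ab.
  move: ab; rewrite add0n => ->; rewrite !KQ_rec (xV n.+3 1%N) ?addn1 //.
  by rewrite (xV n.+2 2%N) ?addn2 //=; ring.
rewrite (IH b.+1) ?addnS -?addSn // [KQ _ b.+2]KQ_rec (xV b.+2 a.+3); last lia.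
by rewrite [KP x a.+2]KP_rec; ring.
Qed.

Lemma KPQ_det (R : realType) (x : R[i]) (n : nat) : `|x| = 1 ->
  `|KP x n.+1 * KQ x n - KP x n * KQ x n.+1| = 1.
Proof.
move=> x1; elim: n => [|n IH].
  by rewrite /= !mulr1 addrAC subrr add0r.
have -> : KP x n.+2 * KQ x n.+1 - KP x n.+1 * KQ x n.+2 =
    - x ^+ n.+2 * (KP x n.+1 * KQ x n - KP x n * KQ x n.+1).
  by rewrite KP_rec KQ_rec; ring.
by rewrite normrM normrN normrX x1 expr1n mul1r IH.
Qed.

Lemma primitive_rootV (F : fieldType) (x : F) (m : nat) :
  m.-primitive_root x -> m.-primitive_root x^-1.
Proof.
move=> xm; have m0 := prim_order_gt0 xm.
have x0 : x != 0 by rewrite (prim_root_eq0 xm) -lt0n.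
have -> : x^-1 = x ^+ m.-1.
  by apply: (mulfI x0); rewrite mulfV // -exprS prednK // (prim_expr_order xm).
rewrite prim_root_exp_coprime //.
by case: m m0 {xm} => // m _; apply: coprimenS.
Qed.

(** * Convergents near a root of unity *)

Lemma q_recurrent_bound (C : numFieldType) (x : C) (u : nat -> C) :
  `|x| = 1 -> q_recurrent x u -> `|u 0%N| <= 1 -> `|u 1%N| <= 2 ->
  forall n, `|u n| <= 2 ^+ n.
Proof.
move=> x1 ru u0 u1 n; have [k] := ubnP n; elim: k n => // k IH [|[|n]] nk //.
rewrite ru (le_trans (ler_normD _ _)) // normrM normrX x1 expr1n mul1r.
have h1 : `|u n.+1| <= 2 ^+ n.+1 by apply: IH; lia.
have h2 : `|u n| <= 2 ^+ n by apply: IH; lia.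
rewrite (le_trans (lerD h1 h2)) //.
have -> : 2 ^+ n.+2 = 2 ^+ n.+1 + 2 ^+ n + 2 ^+ n :> C by rewrite !exprS; ring.
by rewrite lerDl exprn_ge0.
Qed.

Lemma norm_expB_le (C : numFieldType) (x y : C) (n : nat) :
  `|x| = 1 -> `|y| = 1 -> `|x ^+ n - y ^+ n| <= n%:R * `|x - y|.
Proof.
move=> x1 y1; elim: n => [|n IH]; first by rewrite subrr normr0 mul0r.
have -> : x ^+ n.+1 - y ^+ n.+1 = x * (x ^+ n - y ^+ n) + (x - y) * y ^+ n.
  by rewrite !exprS; ring.
rewrite (le_trans (ler_normD _ _)) // !normrM normrX x1 y1 expr1n mul1r mulr1.
by rewrite -natr1 mulrDl mul1r lerD2r.
Qed.

(** The constant [4^n] is generous: the error at [n + 2] is at most the sum of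
    the two previous errors and of [(n + 2) 2^n |y - x|]. *)
Lemma q_recurrent_lipschitz (C : numFieldType) (x y : C) (u v : nat -> C) :
  `|x| = 1 -> `|y| = 1 -> q_recurrent x u -> q_recurrent y v ->
  `|u 0%N| <= 1 -> `|u 1%N| <= 2 -> v 0%N = u 0%N ->
  `|v 1%N - u 1%N| <= `|y - x| ->
  forall n, `|v n - u n| <= 4 ^+ n * `|y - x|.
Proof.
move=> x1 y1 ru rv u0 u1 uv0 uv1 n; have [k] := ubnP n.
elim: k n => // k IH [|[|n]] nk.
- by rewrite uv0 subrr normr0 mulr_ge0.
- by rewrite (le_trans uv1) // expr1 ler_peMl // ler1n.
have h1 : `|v n.+1 - u n.+1| <= 4 ^+ n.+1 * `|y - x| by apply: IH; lia.
have h2 : `|v n - u n| <= 4 ^+ n * `|y - x| by apply: IH; lia.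
have h3 : `|(y ^+ n.+2 - x ^+ n.+2) * u n| <= 4 ^+ n.+1 * `|y - x|.
  rewrite normrM (le_trans (ler_pM _ _ (norm_expB_le _ y1 x1)
    (q_recurrent_bound x1 ru u0 u1 n))) // mulrAC ler_wpM2r //.
  rewrite -!natrX -natrM ler_nat (leq_trans (leq_mul (ltnW (ltn_expl _ (isT : 1 < 2)%N)) (leqnn _))) //.
  by rewrite -expnD -(expnM 2 2) leq_pexp2l //; lia.
rewrite ru rv.
have -> : v n.+1 + y ^+ n.+2 * v n - (u n.+1 + x ^+ n.+2 * u n) =
  (v n.+1 - u n.+1) + (y ^+ n.+2 * (v n - u n) + (y ^+ n.+2 - x ^+ n.+2) * u n).
  by ring.
rewrite (le_trans (ler_normD _ _)) //.
have h4 : `|y ^+ n.+2 * (v n - u n) + (y ^+ n.+2 - x ^+ n.+2) * u n| <=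
   4 ^+ n * `|y - x| + 4 ^+ n.+1 * `|y - x|.
  rewrite (le_trans (ler_normD _ _)) // lerD // normrM normrX y1 expr1n.
  by rewrite mul1r.
rewrite (le_trans (lerD h1 h4)) // -!mulrDl ler_wpM2r //.
rewrite -!natrX -!natrD ler_nat !expnS; lia.
Qed.

Lemma norm_primitive_root (C : numFieldType) (x : C) (m : nat) :
  m.-primitive_root x -> `|x| = 1.
Proof.
move=> xm; apply/eqP; rewrite -(@pexpr_eq1 _ _ m) ?(prim_order_gt0 xm) //.
by rewrite -normrX (prim_expr_order xm) normr1.
Qed.

(** A number of modulus at least [2^-m], perturbed by at most [4^-m], keeps a
    modulus of at least [2^-m - 4^-m = (2^m - 1) 4^-m]. *)
Lemma dominance_stable (C : numFieldType) (m : nat) (a a' b' : C) :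
  (0 < m)%N -> 2 ^- m <= `|a| -> `|a' - a| <= 4 ^- m -> `|b'| <= 4 ^- m ->
  a' != 0 /\ (2 ^+ m - 1) * `|b'| <= `|a'|.
Proof.
move=> m0 ha ha' hb.
have m1 : 1 < 2 ^+ m :> C by rewrite exprn_egt1 ?ltr1n // -lt0n.
have h : (2 ^+ m - 1) * 4 ^- m <= `|a'|.
  have -> : (2 ^+ m - 1) * 4 ^- m = 2 ^- m - 4 ^- m :> C.
    have -> : 4 ^+ m = 2 ^+ m * 2 ^+ m :> C.
      by rewrite -exprMn -natrM.
    by field; rewrite expf_neq0 // pnatr_eq0.
  rewrite (le_trans (lerB ha ha')) //.
  by rewrite lerBlDr -{1}(subrK a' a) distrC addrC ler_normD.
split; last by rewrite (le_trans _ h) // ler_wpM2l // subr_ge0 ltW.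
by rewrite -normr_gt0 (lt_le_trans _ h) // mulr_gt0 ?subr_gt0 // invr_gt0 exprn_gt0.
Qed.

Lemma scaled_error_le (C : numFieldType) (m k : nat) (D : C) :
  (k <= m)%N -> D <= 16 ^- m -> 4 ^+ k * D <= 4 ^- m.
Proof.
move=> km yx; rewrite (le_trans (ler_wpM2l _ yx)) ?exprn_ge0 //.
rewrite ler_pdivrMr ?exprn_gt0 // mulrC.
have -> : 16 ^+ m = 4 ^+ m * 4 ^+ m :> C by rewrite -exprMn -natrM.
by rewrite mulfK ?expf_neq0 ?pnatr_eq0 // ler_weXn2l // ler1n.
Qed.

(** At a root of unity where two entries of the matrix of convergents vanish,
    the determinant identity makes the other two inverse to each other in
    modulus. *)
Lemma norm_ge_of_inverse (C : numFieldType) (m k : nat) (a b : C) :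
  (k <= m)%N -> a * b = 1 -> 0 <= a -> b <= 2 ^+ k -> 2 ^- m <= a.
Proof.
move=> km ab a0 bk; have b1 : b <= 2 ^+ m.
  by rewrite (le_trans bk) // ler_weXn2l // ler1n.
by rewrite -div1r ler_pdivrMr ?exprn_gt0 // -[leLHS]ab ler_wpM2l.
Qed.

(** At [x] itself the convergents of index [m - 1] and [m - 2] are [oo] and
    [0]; the error [16^-m] leaves [4^-m] after amplification by [4^m], still
    far below the lower bound [2^-m] for the nonzero entries. *)
Lemma convergents_near_unity (R : realType) (x y : R[i]) (m : nat) :
  (5 %| m)%N -> m.-primitive_root x -> `|y| = 1 -> `|y - x| <= 16 ^- m ->
  (KP y m.-1 != 0 /\ (2 ^+ m - 1) * `|KQ y m.-1| <= `|KP y m.-1|) /\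
  (KQ y m.-2 != 0 /\ (2 ^+ m - 1) * `|KP y m.-2| <= `|KQ y m.-2|).
Proof.
move=> m5 xm y1 yx; have m0 := prim_order_gt0 xm.
have x1 := norm_primitive_root xm.
have [n mn] : exists n, m = n.+4 by exists (m - 4)%N; case/dvdnP: m5 m0 => s ->; case: s => // s _; lia.
have Q0 := KQ_unity m5 xm.
have P0 : KP x m.-2 = 0.
  have := KQ_unity m5 (primitive_rootV xm).
  by have := prim_expr_order xm; rewrite mn => xn; rewrite -KP_reverse.
have small k (km : (k <= m)%N) := scaled_error_le km yx.
have P1 : `|KP x 1| <= 2 by rewrite /= (le_trans (ler_normD _ _)) // normr1 x1.
have Q1 : `|KQ x 1| <= 2 by rewrite /= normr1 ler1n.
have I1 : `|1 : R[i]| <= 1 by rewrite normr1.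
have Pb := q_recurrent_bound x1 (KP_rec x) I1 P1.
have Qb := q_recurrent_bound x1 (KQ_rec x) I1 Q1.
have LP k : (k <= m)%N -> `|KP y k - KP x k| <= 4 ^- m.
  move=> km; rewrite (le_trans _ (small k km)) //.
  apply: (q_recurrent_lipschitz x1 y1 (KP_rec x) (KP_rec y)) => //=.
  by rewrite opprD addrACA subrr add0r.
have LQ k : (k <= m)%N -> `|KQ y k - KQ x k| <= 4 ^- m.
  move=> km; rewrite (le_trans _ (small k km)) //.
  by apply: (q_recurrent_lipschitz x1 y1 (KQ_rec x) (KQ_rec y)) => //=; rewrite subrr normr0.
have det : `|KP x m.-1| * `|KQ x m.-2| = 1.
  have := KPQ_det m.-2 x1.
  have -> : (m.-2.+1 = m.-1)%N by lia.
  by rewrite P0 mul0r subr0 normrM.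
have le2 : (m.-2 <= m)%N by lia.
have Qy : `|KQ y m.-1| <= 4 ^- m.
  by have := LQ m.-1 (leq_pred m); rewrite Q0 subr0.
have Py : `|KP y m.-2| <= 4 ^- m by have := LP m.-2 le2; rewrite P0 subr0.
split.
  apply: (dominance_stable m0 _ (LP m.-1 (leq_pred m)) Qy).
  exact: (norm_ge_of_inverse le2 det (normr_ge0 _) (Qb _)).
apply: (dominance_stable m0 _ (LQ m.-2 le2) Py).
rewrite mulrC in det.
exact: (norm_ge_of_inverse (leq_pred m) det (normr_ge0 _) (Pb _)).
Qed.

(** * The unit circle *)

Definition cis (R : realType) (r : R) : R[i] := cos r +i* sin r.

Lemma cexp_cis (R : realType) (r : R) : cexp ('i%C * r%:C) = cis r.
Proof.
have -> : 'i%C * r%:C = 0 +i* r :> R[i].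
  by apply/eqP; rewrite eq_complex /= !mul0r !mul1r subrr add0r !eqxx.
by rewrite /cexp /= expR0 mul1r.
Qed.

Lemma cisD (R : realType) (a b : R) : cis (a + b) = cis a * cis b.
Proof.
by rewrite /cis cosD sinD [_ + cos a * sin b]addrC.
Qed.

Lemma cisMn (R : realType) (a : R) (n : nat) : cis (a *+ n) = cis a ^+ n.
Proof.
elim: n => [|n IH]; last by rewrite mulrS cisD IH exprS.
by rewrite mulr0n /cis cos0 sin0.
Qed.

Lemma norm_cis (R : realType) (a : R) : `|cis a| = 1.
Proof. by rewrite normc_def /= cos2Dsin2 sqrtr1. Qed.

Lemma lipschitz1_derive (R : realType) (f g : R -> R) :
  (forall x : R, is_derive x 1 f (g x)) -> (forall x, `|g x| <= 1) ->
  forall a b, `|f a - f b| <= `|a - b|.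
Proof.
move=> fg g1 a b; wlog ab : a b / a <= b.
  move=> H; have [/H//|/ltW/H] := leP a b.
  by rewrite distrC [`|b - a|]distrC.
have [|c _ fc] := @MVT_segment _ f g a b ab (fun x _ => fg x).
  apply: continuous_subspaceT => x.
  by apply/differentiable_continuous/derivable1_diffP; apply: ex_derive.
by rewrite distrC fc normrM [`|a - b|]distrC ler_piMl.
Qed.

Lemma cis_lipschitz (R : realType) (a b : R) :
  `|cis a - cis b| <= (2 * `|a - b|)%:C.
Proof.
have c1 : `|cos a - cos b| <= `|a - b|.
  apply: (lipschitz1_derive (g := fun x => - sin x)) => x.
  by rewrite normrN ler_norml sin_geN1 sin_le1.
have s1 : `|sin a - sin b| <= `|a - b|.
  apply: (lipschitz1_derive (g := fun x => cos x)) => x.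
  by rewrite ler_norml cos_geN1 cos_le1.
have sq (u : R) : `|u| <= `|a - b| -> u ^+ 2 <= `|a - b| ^+ 2.
  by move=> h; rewrite -[u ^+ 2]real_normK ?num_real // ler_pXn2r ?nnegrE.
rewrite normc_def lecR /= -[leRHS]ger0_norm ?mulr_ge0 // -sqrtr_sqr.
apply: ler_wsqrtr; have := lerD (sq _ c1) (sq _ s1).
have := sqr_ge0 `|a - b|; rewrite exprMn; set D := `|a - b| ^+ 2; lra.
Qed.

(** The order [m] of this root divides [d]; if [m < d] then
    [cos (2 pi m / d) = 1] would force [sin (pi m / d) = 0] with
    [0 < pi m / d < pi]. *)
Lemma cis_primitive (R : realType) (d : nat) :
  (0 < d)%N -> d.-primitive_root (cis (2 * pi / d%:R : R)).
Proof.
move=> d0; have dR : 0 < d%:R :> R by rewrite ltr0n.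
have z1 : cis (2 * pi / d%:R : R) ^+ d = 1.
  rewrite -cisMn -[_ *+ d]mulr_natr mulfVK ?gt_eqF //.
  by rewrite mulr_natl /cis cos2pi sin2pi.
have [m zm md] := prim_order_exists d0 z1.
have m0 := prim_order_gt0 zm.
have := dvdn_leq d0 md; rewrite leq_eqVlt => /predU1P[mE|ltmd]; first by rewrite -{1}mE.
have /eqP := prim_expr_order zm.
rewrite -cisMn eq_complex /= => /andP[/eqP + _].
set a := _ *+ m; have -> : a = (pi * (m%:R / d%:R)) *+ 2.
  by rewrite /a -mulr_natl -mulr_natr; ring.
have /sin_gt0_pi s0 : 0 < (pi : R) * (m%:R / d%:R) < pi.
  rewrite mulr_gt0 ?pi_gt0 ?divr_gt0 ?ltr0n //=.
  by rewrite -[ltRHS]mulr1 ltr_pM2l ?pi_gt0 // ltr_pdivrMr // mul1r ltr_nat.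
rewrite cos_mulr2n cos2sin2 => h.
have : 0 < sin (pi * (m%:R / d%:R)) ^+ 2 :> R by rewrite exprn_gt0.
by move: h; set s := sin _ ^+ 2; lra.
Qed.

(** The map [t |-> exp (2 pi i t)] is [4 pi]-Lipschitz and [4 pi <= 16], which
    uses up the extra factor 16 of the hypothesis. *)
Lemma cis_near_primitive_root (R : realType) (t : R) (c d : nat) :
  (0 < d)%N -> coprime c d -> `|t - c%:R / d%:R| <= 16 ^- d.+1 ->
  exists2 x : R[i], d.-primitive_root x & `|cis (2 * pi * t) - x| <= 16 ^- d.
Proof.
move=> d0 cd tcd; exists (cis (2 * pi / d%:R) ^+ c).
  by rewrite prim_root_exp_coprime // cis_primitive.
rewrite -cisMn (le_trans (cis_lipschitz _ _)) //.
have -> : 16 ^- d = (16 ^- d)%:C :> R[i].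
  by rewrite fmorphV rmorphXn /= rmorph_nat.
rewrite lecR -[_ *+ c]mulr_natr.
have -> : 2 * pi * t - 2 * pi / d%:R * c%:R = 2 * pi * (t - c%:R / d%:R) :> R by ring.
rewrite normrM ger0_norm ?mulr_ge0 ?pi_ge0 // mulrA.
have pi4 : 2 * (2 * pi) <= 16 :> R by have := @pihalf_lt2 R; lra.
have -> : 16 ^- d = 16 * 16 ^- d.+1 :> R by rewrite exprS; field; rewrite expf_neq0 ?pnatr_eq0.
by rewrite ler_pM // ?mulr_ge0 ?pi_ge0.
Qed.

(** * Convergence in the extended plane *)

Lemma norm_complex_le (R : realType) (z : R[i]) :
  `|z| <= (`|complex.Re z| + `|complex.Im z|)%:C.
Proof.
rewrite normc_def lecR -[leRHS]ger0_norm ?addr_ge0 // -sqrtr_sqr.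
apply: ler_wsqrtr; rewrite sqrrD !real_normK ?num_real // lerD2r lerDl.
by rewrite mulrn_wge0 // mulr_ge0.
Qed.

Lemma continuous_Complex (R : realType) :
  continuous (fun p : R * R => (p.1 +i* p.2 : R[i]^o)).
Proof.
move=> [a b]; apply/cvgrPdist_lt => -[e e']; rewrite ltcE /= => /andP[/eqP -> e0].
have e2 : 0 < e / 2 by rewrite divr_gt0.
near=> p; apply: (le_lt_trans (norm_complex_le _)); rewrite ltcR /=.
rewrite [e]splitr ltrD //; near: p.
  have cfst : (fst p @[p --> (a, b)] --> a)%classic by exact: cvg_fst.
  by move/cvgrPdist_lt : cfst => /(_ _ e2).
have csnd : (snd p @[p --> (a, b)] --> b)%classic by exact: cvg_snd.
by move/cvgrPdist_lt : csnd => /(_ _ e2).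
Unshelve. all: by end_near. Qed.

Section ExtendedPlane.
Local Open Scope classical_set_scope.

(** The image of the square [[-1, 1] x [-1, 1]], compact as a product of
    segments: neighbourhoods of [oo] are complements of compact closed sets. *)
Lemma unit_disc_compact (R : realType) :
  exists W : set R[i]^o, [/\ compact W, closed W & [set z | `|z| <= 1] `<=` W].
Proof.
pose f (p : R * R) : R[i]^o := p.1 +i* p.2.
have cW : compact (f @` (`[-1, 1] `*` `[-1, 1])).
  apply: continuous_compact; last by apply: compact_setX; apply: segment_compact.
  exact/continuous_subspaceT/continuous_Complex.
exists (f @` (`[-1, 1] `*` `[-1, 1])); split => //.
  by apply: compact_closed cW; apply: norm_hausdorff.
move=> [a b] /= ab; exists (a, b) => //=; rewrite !in_itv /= -!ler_norml.
move: ab; rewrite normc_def /= lecR => ab.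
have sq1 (u v : R) : Num.sqrt (u ^+ 2 + v ^+ 2) <= 1 -> `|u| <= 1.
  by apply: le_trans; rewrite -sqrtr_sqr; apply: ler_wsqrtr; rewrite lerDl sqr_ge0.
by split; [apply: (sq1 a b)|apply: (sq1 b a); rewrite addrC].
Qed.

(** What remains of convergence in the extended plane: the finite terms
    eventually leave the unit disc (limit [oo]), or all terms are eventually
    finite and bounded (finite limit). *)
Lemma Chat_cvg_dichotomy (R : realType) (u : nat -> Chat R) (l : Chat R) :
  u @ \oo --> l ->
  (exists N, forall n, (N <= n)%N -> forall w, u n = Some w -> 1 < `|w|) \/
  (exists N, exists B : nat, forall n, (N <= n)%N ->
     exists2 w, u n = Some w & `|w| <= B%:R).
Proof.
case: l => [l|] ul.
  right.
  have /ul [N _ uN] : nbhs (Some l : Chat R) (Some @` [set w : R[i]^o | `|l - w| < 1]).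
    apply: one_point_compactification_some_nbhs.
    by have := @nbhsx_ballx _ (R[i]^o) l 1 ltr01; rewrite -ball_normE.
  have [B lB] : exists B : nat, `|l| + 1 <= B%:R.
    exists (Num.truncn (complex.Re `|l| + 1)).+1.
    rewrite normc_def -(rmorph1 (real_complex R)) -rmorphD -(rmorph_nat (real_complex R)).
    by rewrite lecR /= ltW // truncnS_gt.
  exists N, B => n Nn; have [w /= lw uw] := uN n Nn; exists w => //.
  rewrite (le_trans _ lB) // -[w](subKr l) (le_trans (ler_normB _ _)) //.
  by rewrite lerD2l ltW.
left; have [W [cW clW dW]] := unit_disc_compact R.
have /ul [N _ uN] : nbhs (None : Chat R) ((Some @` (~` W)) `|` [set None]).
  by exists W.
exists N => n Nn w unw; have [] := uN n Nn; rewrite /= unw; last by [].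
move=> [w' nW [ww']]; rewrite ww' in nW.
rewrite real_ltNge ?normr_real ?real1 //; apply/negP => w1; exact/nW/dW.
Qed.

End ExtendedPlane.

(** * Regular continued fractions *)

(** Numerator and denominator of [[0, b_1, ..., b_n]], computed from the last
    partial quotient to the first, as [cfrac] is. *)
Fixpoint cfrac_pair (s : seq nat) : nat * nat :=
  if s is b :: s' then
    ((cfrac_pair s').2, b * (cfrac_pair s').2 + (cfrac_pair s').1)%N
  else (0, 1)%N.

Lemma cfrac_ge0 (R : realType) (s : seq nat) : 0 <= cfrac R s.
Proof. by elim: s => //= b s IH; rewrite invr_ge0 addr_ge0. Qed.

Lemma cfrac_pair_gt0 (s : seq nat) :
  all (leq 1) s -> (0 < (cfrac_pair s).2)%N.
Proof. by elim: s => //= b s IH /andP[b0 /IH]; rewrite addn_gt0 muln_gt0 b0 => ->. Qed.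

Lemma cfrac_pair_coprime (s : seq nat) :
  coprime (cfrac_pair s).1 (cfrac_pair s).2.
Proof.
elim: s => //= b s; rewrite /coprime gcdnC => /eqP IH.
by rewrite gcdnMDl IH.
Qed.

Lemma cfrac_pairE (R : realType) (s : seq nat) : all (leq 1) s ->
  cfrac R s = (cfrac_pair s).1%:R / (cfrac_pair s).2%:R.
Proof.
elim: s => [|b s IH] /=; first by rewrite mul0r.
move=> /andP[b0 s0]; have := cfrac_pair_gt0 s0.
rewrite (IH s0) natrD natrM -(ltr0n R); set d := _%:R => d0.
rewrite -[in RHS]invf_div; congr (_^-1).
by rewrite mulrDl mulfK ?gt_eqF.
Qed.

Lemma cfrac_pair_le (s : seq nat) : all (leq 1) s ->
  ((cfrac_pair s).1 <= (cfrac_pair s).2)%N.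
Proof. by case: s => //= b s /andP[b0 _]; rewrite -[X in (X <= _)%N]mul1n; nia. Qed.

Lemma cfrac_pair_le_prod (s : seq nat) : all (leq 1) s ->
  ((cfrac_pair s).2 <= \prod_(b <- s) b.+1)%N.
Proof.
elim: s => [|b s IH] /=; first by rewrite big_nil.
move=> /andP[b0 s0]; rewrite big_cons; have := cfrac_pair_le s0.
by have := IH s0; nia.
Qed.

Lemma cfrac_pair_ge_size (s : seq nat) : all (leq 2) s ->
  (size s < (cfrac_pair s).2)%N.
Proof. by elim: s => //= b s IH /andP[b0 /IH]; nia. Qed.

(** Each step [z |-> 1 / (b + z)] with [b >= 1] is 1-Lipschitz on [z >= 0], so
    cutting off a tail changes the value by at most the tail itself. *)
Lemma cfrac_cat_dist (R : realType) (s s' : seq nat) : all (leq 1) s ->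
  `|cfrac R (s ++ s') - cfrac R s| <= cfrac R s'.
Proof.
elim: s => [|b s IH] /=; first by rewrite subr0 ger0_norm ?cfrac_ge0.
move=> /andP[b0 s0]; apply: le_trans (IH s0).
have := cfrac_ge0 R s; have := cfrac_ge0 R (s ++ s').
set u := cfrac R (s ++ s'); set v := cfrac R s => u0 v0.
have b1 : 1 <= b%:R :> R by rewrite ler1n.
have bu : 1 <= b%:R + u by rewrite ler_wpDr.
have bv : 1 <= b%:R + v by rewrite ler_wpDr.
have -> : (b%:R + u)^-1 - (b%:R + v)^-1 = (v - u) * ((b%:R + u)^-1 * (b%:R + v)^-1).
  by field; rewrite !gt_eqF //; lra.
rewrite normrM distrC ler_piMr // ger0_norm; last by rewrite mulr_ge0 // invr_ge0; lra.
by rewrite mulr_ile1 ?invr_ge0 ?invf_le1 //; lra.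
Qed.

Lemma regular_cfrac_dist (R : realType) (a : nat -> nat) (t : R) (n : nat) :
  regular_cfrac a t ->
  `|t - cfrac R [seq a i | i <- iota 1 n]| <= (a n.+1)%:R^-1.
Proof.
move=> [a0 at_]; apply/ler_addgt0Pr => e e0.
have /cvgrPdist_lt/(_ e e0) [N _ tN] := at_.
have := tN (maxn N n.+1) (leq_maxl _ _) => /= h.
rewrite -(subrKA (cfrac R [seq a i | i <- iota 1 (maxn N n.+1)])).
rewrite (le_trans (ler_normD _ _)) // addrC lerD ?(ltW h) //.
have -> : maxn N n.+1 = (n + (maxn N n.+1 - n.+1).+1)%N by lia.
rewrite iotaD map_cat (le_trans (cfrac_cat_dist _ _ _)) //.
  by apply/allP => _ /mapP[i + ->]; rewrite mem_iota => /andP[i0 _]; apply: a0.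
rewrite /= add1n lef_pV2 ?posrE ?ler_wpDr ?cfrac_ge0 ?ltr0n ?a0 //.
by rewrite ltr_wpDr ?cfrac_ge0 ?ltr0n ?a0.
Qed.

(** When all partial quotients are 1 modulo 5 the pair is [(F_n, F_(n+1))]
    modulo 5 for [n = size s], and five more steps multiply it by 3. From
    [(F_2, F_3) = (1, 2)] on, every fifth pair is thus proportional to
    [(1, 2)], and [1 + 2 * 2 = 5]. *)
Lemma cfrac_pair_mod5 (s : seq nat) (l : nat) :
  all (fun b => b %% 5 == 1)%N s -> size s = (5 * l).+2 ->
  (5 %| (cfrac_pair s).1 + 2 * (cfrac_pair s).2)%N.
Proof.
have step b r : (b %% 5 == 1)%N ->
    ((b * (cfrac_pair r).2 + (cfrac_pair r).1) %% 5 =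
     ((cfrac_pair r).2 + (cfrac_pair r).1) %% 5)%N.
  by move=> /eqP b1; rewrite -modnDml -modnMml b1 mul1n modnDml.
elim: l s => [|l IH] s.
  case: s => [|b1 [|b2 []]] //= /and3P[h1 h2 _] _.
  by have := step b2 [::] h2; rewrite /=; have := step b1 [:: b2] h1; rewrite /=; lia.
case: s => [|b1 [|b2 [|b3 [|b4 [|b5 s]]]]] //; try by rewrite /=; lia.
move=> /and5P[h1 h2 h3 h4 /andP[h5 hs]] sz; have := IH s hs.
have -> : size s = (5 * l).+2 by move: sz => /=; lia.
move=> /(_ erefl).
have := step _ (b2 :: b3 :: b4 :: b5 :: s) h1; have := step _ (b3 :: b4 :: b5 :: s) h2.
have := step _ (b4 :: b5 :: s) h3; have := step _ (b5 :: s) h4.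
have := step _ s h5; rewrite /=.
set c := (cfrac_pair s).1; set d := (cfrac_pair s).2.
set e5 := (b5 * d + c)%N; set e4 := (b4 * e5 + d)%N; set e3 := (b3 * e4 + e5)%N.
set e2 := (b2 * e3 + e4)%N; set e1 := (b1 * e2 + e3)%N.
clearbody e1 e2 e3 e4 e5 c d; lia.
Qed.

(** * Towers *)

Lemma towerS (j z : nat) : tower j.+1 z = (2 ^ tower j z)%N.
Proof. by []. Qed.

Lemma tower_ge (j z : nat) : (z <= tower j z)%N.
Proof. by elim: j => //= j IH; rewrite (leq_trans IH) // ltnW // ltn_expl. Qed.

Lemma tower_double (j z : nat) : (2 * tower j.+1 z <= tower j.+1 z.+1)%N.
Proof.
elim: j => [|j IH]; first by rewrite /= expnS.
rewrite [tower j.+2 z]towerS [tower j.+2 z.+1]towerS -expnS leq_pexp2l //.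
have : (0 < tower j.+1 z)%N by rewrite /= expn_gt0.
by move: IH => /=; lia.
Qed.

Lemma tower_mod5 (j z : nat) : (1 < z)%N -> (tower j.+2 z %% 5 = 1)%N.
Proof.
move=> z1; rewrite !towerS.
have := leq_trans z1 (tower_ge j z); case: (tower j z) => [|[|k]] // _.
rewrite (expnS _ k.+1) (expnS _ k) mulnA expnM.
by rewrite -modnXm exp1n.
Qed.

Lemma tower_gt_double (j z : nat) : (2 * tower j.+1 z < tower j.+2 z.+1)%N.
Proof.
rewrite [tower j.+2 z.+1]towerS (leq_trans (ltn_expl _ (isT : (1 < 2)%N))) //.
by rewrite leq_pexp2l //; apply: tower_double.
Qed.

(** The exponents [T_k(k + 1)] of the partial quotients [a_(k+1)] more than
    double at each step, so the last one exceeds the sum of its predecessors,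
    with a margin that grows with their number. *)
Lemma tower_sum (m : nat) :
  (m + 6 + \sum_(0 <= k < m.+2) tower k k.+1 <= tower m.+2 m.+3)%N.
Proof.
elim: m => [|m IH]; first by rewrite !big_nat_recr //= big_geq.
have -> : (\sum_(0 <= k < m.+3) tower k k.+1 =
  \sum_(0 <= k < m.+2) tower k k.+1 + tower m.+2 m.+3)%N by rewrite big_nat_recr.
have := tower_gt_double m.+1 m.+3; move: IH; set s := bigop _ _ _.
by move: (tower m.+2 m.+3) (tower m.+3 m.+4) s; lia.
Qed.

Lemma tower_prod (n : nat) :
  (\prod_(b <- [seq tower i i | i <- iota 1 n]) b.+1 <=
   2 ^ (n + \sum_(0 <= k < n) tower k k.+1))%N.
Proof.
have -> : iota 1 n = index_iota 1 n.+1 by rewrite /index_iota subn1.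
rewrite big_map big_add1 /=.
elim: n => [|n IH]; first by rewrite !big_geq.
rewrite !big_nat_recr //=.
have -> : (n.+1 + (\sum_(0 <= k < n) tower k k.+1 + tower n n.+1) =
  n + \sum_(0 <= k < n) tower k k.+1 + (tower n n.+1).+1)%N by lia.
rewrite expnD leq_mul //.
by have := expn_gt0 2 (tower n n.+1); rewrite expnS; lia.
Qed.

(** The product bounds the denominator of the [n]-th convergent
    ([cfrac_pair_le_prod]). It is at most [2^(n + s)], where [s] is the sum of
    the exponents of [a_1, ..., a_n], so that the claim compares [3 + n + s]
    with the second iterated logarithm [T_(n-1)(n+1)] of the tower; the latter
    is at least twice [T_(n-1)(n)], and [tower_sum] bounds the other terms of
    [3 + n + s] by [T_(n-1)(n)]. *)
Lemma tower_dominates (n : nat) : (2 < n)%N ->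
  (16 ^ (\prod_(b <- [seq tower i i | i <- iota 1 n]) b.+1).+1 <= tower n.+1 n.+1)%N.
Proof.
case: n => [|[|[|m]]] // _; set P := bigop _ _ _.
have -> : (16 ^ P.+1 = 2 ^ (4 * P.+1))%N by rewrite expnM.
rewrite [tower m.+4 _]towerS leq_pexp2l //.
have P0 : (0 < P)%N by apply: prodn_gt0.
rewrite (@leq_trans (2 ^ 3 * P)%N) //; first by lia.
rewrite (leq_trans (leq_mul (leqnn _) (tower_prod m.+3))) // -expnD.
rewrite [tower m.+3 _]towerS leq_pexp2l //.
have -> : (\sum_(0 <= k < m.+3) tower k k.+1 =
  \sum_(0 <= k < m.+2) tower k k.+1 + tower m.+2 m.+3)%N by rewrite big_nat_recr.
have := tower_double m.+1 m.+3; have := tower_sum m.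
by set s := bigop _ _ _; move: (tower m.+2 m.+3) (tower m.+2 m.+4) s; lia.
Qed.

(** The first partial quotient is 2, so the denominator is [c' + 2 d'] for the
    pair [(c', d')] of the others, which are 1 modulo 5; taking [5 N + 2] of
    them makes it divisible by 5. *)
Lemma tower_cfrac_approx (R : realType) (t : R) (N : nat) :
  regular_cfrac (fun i : nat => tower i i) t ->
  exists c d : nat, [/\ (N <= d)%N, (5 %| d)%N, coprime c d &
    `|t - c%:R / d%:R| <= 16 ^- d.+1].
Proof.
move=> t_cf; pose n := (5 * N).+3; pose s := [seq tower i i | i <- iota 1 n].
have s2 : all (leq 2) s.
  apply/allP => _ /mapP[[|[|i]] + ->]; rewrite mem_iota //.
  by move=> _; apply: leq_trans (tower_ge _ _).
have s1 : all (leq 1) s by apply: sub_all s2 => b; apply: ltnW.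
exists (cfrac_pair s).1, (cfrac_pair s).2; split.
- by have := cfrac_pair_ge_size s2; rewrite size_map size_iota /n; lia.
- have -> : s = 2%N :: [seq tower i i | i <- iota 2 (5 * N).+2] by [].
  have -> r : (cfrac_pair (2 :: r)%N).2 =
    ((cfrac_pair r).1 + 2 * (cfrac_pair r).2)%N by rewrite addnC.
  apply: (@cfrac_pair_mod5 _ N); last by rewrite size_map size_iota.
  apply/allP => _ /mapP[[|[|i]] + ->]; rewrite mem_iota // => _.
  by rewrite tower_mod5.
- exact: cfrac_pair_coprime.
rewrite -cfrac_pairE //; apply: (le_trans (regular_cfrac_dist n t_cf)).
rewrite -natrX lef_pV2 ?posrE ?ltr0n ?expn_gt0 // ler_nat.
apply: leq_trans (tower_dominates _); last by [].
by rewrite leq_pexp2l // ltnS; apply: cfrac_pair_le_prod.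
Qed.

(** * Divergence *)

Unset Implicit Arguments.

Theorem corollary1 (R : realType) (t : R)
    (t01 : 0 < t < 1) (t_irr : irrational t)
    (t_cf : regular_cfrac (fun i : nat => tower i i) t) :
  ~ K_converges (cexp ('i%C * (2 * pi * t)%:C)).
Proof.
rewrite cexp_cis; set y := cis _ => -[l].
have near N : exists2 m, (N <= m)%N & exists2 x, (5 %| m)%N /\ m.-primitive_root x &
    `|y - x| <= 16 ^- m.
  have [c [d [Nd d5 cd tcd]]] := tower_cfrac_approx N.+1 t_cf.
  have [x xm yx] := cis_near_primitive_root (leq_trans (ltn0Sn N) Nd) cd tcd.
  by exists d; [apply: ltnW | exists x].
have big N m : (N < m)%N -> N%:R < 2 ^+ m - 1 :> R[i].
  move=> Nm; rewrite ltrBrDr natr1 -natrX ltr_nat.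
  by rewrite (leq_ltn_trans Nm) // ltn_expl.
move=> /Chat_cvg_dichotomy[[N KN]|[N [B KN]]].
- have [m mN [x [m5 xm] yx]] := near N.+2.
  have [Nm m1] : (N <= m.-2)%N /\ (1 < m)%N by lia.
  have [_ [Q0 PQ]] := convergents_near_unity m5 xm (norm_cis _) yx.
  have := KN m.-2 _ (KP y m.-2 / KQ y m.-2); rewrite /Kconvergent (negPf Q0).
  move=> /(_ _ erefl); rewrite normrM normfV ltr_pdivlMr ?normr_gt0 // mul1r.
  move=> /(_ Nm) QP.
  have P1 : `|KP y m.-2| <= (2 ^+ m - 1) * `|KP y m.-2|.
    by rewrite ler_peMl // ltW // (big 1%N).
  by have := lt_le_trans QP (le_trans P1 PQ); rewrite ltxx.
have [m mN [x [m5 xm] yx]] := near (N + B).+2.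
have [Nm /big mB] : (N <= m.-1)%N /\ (B < m)%N by lia.
have [[P0 PQ] _] := convergents_near_unity m5 xm (norm_cis _) yx.
have [w + wB] := KN m.-1 Nm.
rewrite /Kconvergent; case: ifPn => // Q0 [] wE.
have : (2 ^+ m - 1) * `|KQ y m.-1| <= B%:R * `|KQ y m.-1|.
  by rewrite (le_trans PQ) // -ler_pdivrMr ?normr_gt0 // -normfV -normrM wE.
rewrite ler_pM2r ?normr_gt0 // => Bm.
by have := lt_le_trans mB Bm; rewrite ltxx.
Qed.
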